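(* Let $\mathbf k=(k_1,\dots,k_r)$ be a nonempty tuple of positive integers, $r=\mathrm{dep}(\mathbf k)$, and $s=\mathrm{dep}(\mathbf k^\vee)=\mathrm{wt}(\mathbf k)-r+1$. Let $n\ge2$ and $\zeta_n$ a primitive $n$-th root of unity. Then for every $m\ge0$ with $n\ge r+m+1$, \[ \sum_{\substack{\mathbf e\in(\mathbb Z_{\ge0})^s\\ \mathrm{wt}(\mathbf e)=m}} z_n\big((\mathbf k^\vee+\mathbf e)^\vee;\zeta_n\big) =\sum_{l=0}^m\frac1n\binom{n}{m-l+1}(1-\zeta_n)^{m-l}\sum_{\substack{\mathbf e'\in(\mathbb Z_{\ge0})^r\\ \mathrm{wt}(\mathbf e')=l}} z_n(\mathbf k+\mathbf e';\zeta_n). \]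
   Context: For a tuple $\mathbf e=(e_1,\dots,e_r)$ of non-negative integers, $\mathrm{dep}(\mathbf e)=r$ and $\mathrm{wt}(\mathbf e)=\sum_j e_j$; sums of tuples of equal length are componentwise. For $m\ge1$ let $[m]=(1-q^m)/(1-q)$ and $F_k(m)=q^{(k-1)m}/[m]^k$. For a tuple $\mathbf k=(k_1,\dots,k_r)$ of positive integers, $z_n(\mathbf k;\zeta_n)=\sum_{n>m_1>\cdots>m_r\ge1}\prod_{j=1}^rF_{k_j}(m_j)\big|_{q=\zeta_n}$ (zero if $r\ge n$). Hoffman dual: encode a nonempty tuple $\mathbf k=(k_1,\dots,k_r)$ of positive integers as the word $x^{k_1-1}y\,x^{k_2-1}y\cdots x^{k_r-1}y$ in two non-commuting letters $x,y$, and write it uniquely as $w\,y$. Let $\tau$ be the involution on words swapping $x$ and $y$. Then $\mathbf k^\vee$ is the tuple whose word is $\tau(w)\,y$. E.g. $(2,3,1)^\vee=(1,2,1,2)$. *)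

(* Defs.v *)
From mathcomp Require Import all_boot all_order all_algebra.

Set Implicit Arguments.
Unset Strict Implicit.
Unset Printing Implicit Defensive.

Import GRing.Theory.

Definition dep (e : seq nat) : nat := size e.
Definition wt (e : seq nat) : nat := \sum_(a <- e) a.

(* Only used when [dep a = dep b]; [zip] truncates to the shorter sequence. *)
Definition addt (a b : seq nat) : seq nat := [seq p.1 + p.2 | p <- zip a b].

Definition positive (k : seq nat) : bool := all (leq 1) k.

(* A tuple of length s of non-negative integers whose weight is m has all its
   entries in {0, ..., m}, so that these tuples are exactly the [vals e] for
   e : s.-tuple 'I_m.+1 with [wt (vals e) == m]. *)
Definition vals (n s : nat) (e : s.-tuple 'I_n) : seq nat :=
  [seq val i | i <- e].

Inductive letter := X | Y.

Definition word_of_tuple (k : seq nat) : seq letter :=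
  flatten [seq rcons (nseq (a - 1) X) Y | a <- k].

(* [tuple_of_word_rec c w] decodes x^c w. *)
Fixpoint tuple_of_word_rec (c : nat) (w : seq letter) : seq nat :=
  match w with
  | [::] => [::]
  | X :: w' => tuple_of_word_rec c.+1 w'
  | Y :: w' => c.+1 :: tuple_of_word_rec 0 w'
  end.

Definition tuple_of_word (w : seq letter) : seq nat := tuple_of_word_rec 0 w.

Definition tau (w : seq letter) : seq letter :=
  [seq (if a is X then Y else X) | a <- w].

(* [take] drops the last letter, which is y when k is nonempty; the value
   at the empty tuple is irrelevant. *)
Definition hoffman_dual (k : seq nat) : seq nat :=
  let u := word_of_tuple k in
  tuple_of_word (rcons (tau (take (size u).-1 u)) Y).

Lemma tuple_of_word_nseqX c a w :
  tuple_of_word_rec c (nseq a X ++ w) = tuple_of_word_rec (c + a) w.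
Proof. by elim: a c => [|a IH] c /=; rewrite ?addn0 // IH addSnnS. Qed.

Lemma word_of_tupleK k : positive k -> tuple_of_word (word_of_tuple k) = k.
Proof.
elim: k => [//|a k IH] /= /andP[a_gt0 /IH {2}<-].
rewrite /tuple_of_word /word_of_tuple /= cat_rcons tuple_of_word_nseqX /=.
by rewrite add0n -addn1 subnK.
Qed.

Lemma tuple_of_wordK_rec c w :
  word_of_tuple (tuple_of_word_rec c (rcons w Y)) = nseq c X ++ rcons w Y.
Proof.
elim: w c => [|[] w IH] c /=.
- by rewrite /word_of_tuple /= subn1 cats0 -cats1.
- by rewrite IH -addn1 nseqD -catA.
- by rewrite {1}/word_of_tuple /= subn1 cat_rcons -/(word_of_tuple _) IH.
Qed.

Lemma tuple_of_wordK w :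
  word_of_tuple (tuple_of_word (rcons w Y)) = rcons w Y.
Proof. exact: tuple_of_wordK_rec. Qed.

Lemma hoffman_dualE k w : word_of_tuple k = rcons w Y ->
  word_of_tuple (hoffman_dual k) = rcons (tau w) Y.
Proof.
move=> kw; rewrite /hoffman_dual kw tuple_of_wordK size_rcons /=.
by rewrite -[rcons w Y]cats1 take_size_cat.
Qed.

Example hoffman_dual231 : hoffman_dual [:: 2; 3; 1] = [:: 1; 2; 1; 2].
Proof. by []. Qed.

Local Open Scope ring_scope.

Section CyclotomicValues.
Variable C : fieldType.

(* At q = zeta a primitive n-th root of unity and 0 < m < n, [1 - q] and
   [qint q m] are nonzero, so no division by zero occurs. *)
Definition qint (q : C) (m : nat) : C := (1 - q ^+ m) / (1 - q).

Definition Fq (q : C) (k m : nat) : C := q ^+ ((k - 1) * m) / qint q m ^+ k.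

Definition z (n : nat) (k : seq nat) (zeta : C) : C :=
  \sum_(m : (dep k).-tuple 'I_n | sorted gtn (vals m) && all (leq 1) (vals m))
     \prod_(j < dep k) Fq zeta (nth 0%N k j) (tnth m j).

End CyclotomicValues.

(* Main.v *)
Require Import Defs.
From mathcomp Require Import all_boot all_order all_algebra.
From mathcomp Require Import ring zify.

Set Implicit Arguments.
Unset Strict Implicit.
Unset Printing Implicit Defensive.

Import GRing.Theory.
Local Open Scope ring_scope.

(* Write q for the root of unity, u = 1 + (1 - q) t, and refine both families
   of sums by the value of the largest summation index: L_k(p) and R_k(p) are
   the generating series in t of the sums over e of the terms of
   z_n((k^v + e)^v) and z_n(k + e) with m_1 = p.  They are related by a
   triangular kernel,
     L_k(p) = sum_(1 <= m <= p) A_m B_(p-m) R_k(m),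
     A_m = prod_(1 <= i <= m) (1 - u q^i) / (1 - q^i),
     B_j = prod_(0 <= i < j) (u - q^i) / (1 - q^(i+1)),
   by induction on k, which is built from (1) by increasing the first entry and
   by prepending 1 (operations that the Hoffman dual exchanges).  Put
   S_j = sum_(i < j) B_i, which telescopes: (u - 1) S_j = (1 - q^j) B_j.  Since
   q^n = 1, A_m S_(n-m) does not depend on m, so summing over p < n gives
   sum_p L_k(p) = S_n sum_m R_k(m), and n (u - 1) S_n = u^n - 1 gives the
   coefficients (1/n) binom(n, j+1) (1 - q)^j of S_n. *)

(** * Explicit enumerations of the index sets *)

Section Enumerations.
Local Open Scope nat_scope.

Definition inc_head (k : seq nat) : seq nat :=
  if k is a :: k' then a.+1 :: k' else [::].

(** The recursion separates a first entry 0 from a positive one, which is lowered by 1; the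
    recurrences in [l] for the shifted sums come from this dichotomy. *)
Fixpoint weak_compositions (r : nat) : nat -> seq (seq nat) :=
  if r is r'.+1 then
    fix aux l := if l is l'.+1
      then map (cons 0) (weak_compositions r' l) ++ map inc_head (aux l')
      else map (cons 0) (weak_compositions r' 0)
  else fun l => if l is 0 then [:: [::]] else [::].

Lemma wt_cons a e : wt (a :: e) = a + wt e.
Proof. by rewrite /wt big_cons. Qed.

Lemma weak_compositionsSS r l :
  weak_compositions r.+1 l.+1 =
  map (cons 0) (weak_compositions r l.+1) ++
  map inc_head (weak_compositions r.+1 l).
Proof. by []. Qed.

Lemma mem_weak_compositions r l e :
  (e \in weak_compositions r l) = (size e == r) && (wt e == l).
Proof.
elim: r l e => [|r IHr] l e.
  by case: l => [|l]; case: e => [|a e] //=; rewrite /wt big_nil.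
(* The default value 1 makes the test [nth 1 e' 0 == 0] fail on the empty list. *)
have H0 l' e' :
    (e' \in map (cons 0) (weak_compositions r l')) =
    [&& size e' == r.+1, wt e' == l' & nth 1 e' 0 == 0].
  apply/mapP/and3P => [[s]|].
    rewrite IHr => /andP[/eqP <- /eqP <-] ->.
    by rewrite /= wt_cons.
  case: e' => [|a e'] [] //= sz w /eqP a0; exists e'; last by rewrite a0.
  by rewrite IHr -(eqP w) wt_cons a0 eqxx andbT -eqSS.
elim: l e => [|l IHl] e.
  rewrite /= H0; case: e => [|a e] //=; rewrite wt_cons addn_eq0.
  by case: (a == 0); rewrite ?andbF ?andbT.
rewrite weak_compositionsSS mem_cat H0.
have -> : (e \in map inc_head (weak_compositions r.+1 l)) =
    [&& size e == r.+1, wt e == l.+1 & nth 1 e 0 != 0].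
  apply/mapP/and3P => [[s]|].
    rewrite IHl => /andP[]; case: s => [|a s] //= sz /eqP <- ->.
    by rewrite /= !wt_cons addSn.
  case: e => [|[|a] e] [] //= sz w _; exists (a :: e) => //.
  by rewrite IHl /= sz /=; rewrite wt_cons addSn eqSS -wt_cons in w.
by case: (nth 1 e 0 == 0); rewrite /= ?andbF ?andbT ?orbF.
Qed.

Lemma weak_compositions_uniq r l : uniq (weak_compositions r l).
Proof.
have cons0_inj : injective (cons 0) by move=> ? ? [].
elim: r l => [|r IHr]; first by case.
elim=> [|l IHl]; first by rewrite /= map_inj_uniq ?IHr.
rewrite weak_compositionsSS cat_uniq map_inj_uniq ?IHr // andTb.
apply/andP; split.
  by apply/hasPn => _ /mapP[[|a s] _ ->] /=; apply/mapP => -[].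
rewrite map_inj_in_uniq //.
by move=> [|a s] [|b s']; rewrite !mem_weak_compositions // => _ _ [-> ->].
Qed.

Fixpoint decreasing_seqs (r n : nat) : seq (seq nat) :=
  if r is r'.+1 then
    [seq m :: s | m <- index_iota 1 n, s <- decreasing_seqs r' m]
  else [:: [::]].

Lemma mem_decreasing_seqs r n e :
  (e \in decreasing_seqs r n) =
  [&& size e == r, all (gtn n) e & sorted gtn e && all (leq 1) e].
Proof.
elim: r n e => [|r IHr] n e /=; first by case: e.
case: e => [|a e] /=.
  by apply/allpairsPdep => -[m [s []]].
rewrite path_sortedE; last by move=> x y w /= h1 h2; apply: ltn_trans h1.
apply/allpairsPdep/idP => [[m [s [Hm]]]|].
  rewrite IHr mem_index_iota in Hm *.
  case/and3P=> sz lt1 /andP[so le1] [-> ->].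
  case/andP: Hm => m1 mn; rewrite eqSS sz m1 mn lt1 so le1 !andbT /=.
  by apply: sub_all lt1 => x /= /ltn_trans; apply.
case/and3P=> sz /andP[an _] /andP[/andP[lta so] /andP[a1 le1]].
by exists a, e; rewrite mem_index_iota a1 an IHr lta so le1 -eqSS sz.
Qed.

Lemma decreasing_seqs_uniq r n : uniq (decreasing_seqs r n).
Proof.
elim: r n => [|r IHr] n //=.
apply: allpairs_uniq_dep; rewrite ?iota_uniq //.
by move=> [x1 y1] [x2 y2] _ _ /= [-> ->].
Qed.

End Enumerations.

Lemma vals_inj n s : injective (@vals n s).
Proof. by move=> e1 e2 /(inj_map val_inj)/val_inj. Qed.

(** Passes from tuples of ordinals to explicit lists, on which recursion is available. *)
Lemma sum_vals (V : nmodType) (r n : nat) (l : seq (seq nat))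
    (P : pred (seq nat)) (f : seq nat -> V) :
  uniq l ->
  (forall e, (e \in l) = [&& size e == r, all (gtn n) e & P e]) ->
  \sum_(e : r.-tuple 'I_n | P (vals e)) f (vals e) = \sum_(e <- l) f e.
Proof.
move=> l_uniq memE; rewrite -big_filter -(big_map (@vals n r) xpredT f).
apply: perm_big; apply: uniq_perm => //.
  by rewrite map_inj_uniq ?filter_uniq ?index_enum_uniq //; apply: vals_inj.
move=> e; rewrite memE; apply/mapP/and3P => [[t]|[/eqP sz lt Pe]].
  rewrite mem_filter => /andP[Pt _] ->; split=> //.
    by rewrite size_map size_tuple.
  by apply/allP => _ /mapP[i _ ->] /=.
have [t tE] : exists t : r.-tuple 'I_n, vals t = e.
  rewrite -{r memE}sz; elim: e lt {Pe} => [|a e IH] /=; first by exists [tuple].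
  case/andP=> an /IH[t tE]; exists [tuple of Ordinal an :: t].
  exact: (congr1 (cons a) tE).
by exists t; rewrite ?mem_filter ?tE ?Pe ?mem_index_enum.
Qed.

Lemma sum_weak_compositions (V : nmodType) s m (f : seq nat -> V) :
  \sum_(e : s.-tuple 'I_m.+1 | wt (vals e) == m) f (vals e) =
  \sum_(e <- weak_compositions s m) f e.
Proof.
apply: (@sum_vals _ _ _ _ (fun e => wt e == m)).
  exact: weak_compositions_uniq.
move=> e; rewrite mem_weak_compositions; case: (_ == s) => //=.
case: eqP => [<-|_]; last by rewrite andbF.
(* An entry never exceeds the weight, so the bound on the entries is automatic. *)
rewrite andbT; apply/esym/allP => a ae /=.
by rewrite ltnS /wt (big_rem a) //= leq_addr.
Qed.

(** * The Hoffman dual *)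

Section HoffmanDual.
Local Open Scope nat_scope.

Lemma tuple_of_word_recS c w :
  tuple_of_word_rec c.+1 w = inc_head (tuple_of_word_rec c w).
Proof. by elim: w c => [|[] w IH] c //=. Qed.

Lemma positive_tuple_of_word_rec c w : positive (tuple_of_word_rec c w).
Proof. by elim: w c => [|[] w IH] c //=; apply: IH. Qed.

Lemma positive_hoffman_dual k : positive (hoffman_dual k).
Proof. exact: positive_tuple_of_word_rec. Qed.

Lemma hoffman_dual_neq0 k : hoffman_dual k <> [::].
Proof.
rewrite /hoffman_dual /tuple_of_word; move: (tau _) 0.
by elim=> [|[] w IH] c //=; apply: IH.
Qed.

(** The new leading x becomes y under [tau], hence an entry 1; it is not the dropped last letter,
    since the rest of the word is nonempty. *)
Lemma hoffman_dual_inc_head a k :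
  hoffman_dual (a.+2 :: k) = 1 :: hoffman_dual (a.+1 :: k).
Proof.
rewrite /hoffman_dual.
have -> : word_of_tuple (a.+2 :: k) = X :: word_of_tuple (a.+1 :: k).
  by rewrite /word_of_tuple /= !subn1.
have : word_of_tuple (a.+1 :: k) <> [::].
  by rewrite /word_of_tuple /=; case: (nseq _ _).
by case: (word_of_tuple _).
Qed.

(** The new leading y becomes x. For empty [k] it would be the dropped last letter instead. *)
Lemma hoffman_dual_cons1 k : k <> [::] ->
  hoffman_dual (1 :: k) = inc_head (hoffman_dual k).
Proof.
move=> k0; rewrite /hoffman_dual /tuple_of_word -tuple_of_word_recS.
have : word_of_tuple k <> [::].
  by case: k k0 => // a k _; rewrite /word_of_tuple /=; case: (nseq _ _).
rewrite -[word_of_tuple (1 :: k)]/(Y :: word_of_tuple k).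
by case: (word_of_tuple k).
Qed.

Lemma positive_tuple_ind (P : seq nat -> Prop) :
  P [:: 1] ->
  (forall a k, positive (a.+1 :: k) -> P (a.+1 :: k) -> P (a.+2 :: k)) ->
  (forall k, k <> [::] -> positive k -> P k -> P (1 :: k)) ->
  forall k, k <> [::] -> positive k -> P k.
Proof.
move=> P1 Pinc Pcons; elim=> [//|a k IH] _ /= /andP[].
case: a => // a _ k_pos; elim: a => [|a IHa]; last exact: Pinc.
by case: k k_pos IH => [//|b k] k_pos IH; apply: Pcons => //; apply: IH.
Qed.

(** Each induction step raises the weight and exactly one of the two depths by 1. The additive form
    avoids truncated subtraction. *)
Lemma size_hoffman_dual k : k <> [::] -> positive k ->
  dep (hoffman_dual k) + dep k = (wt k).+1.
Proof.
move: k; apply: positive_tuple_ind => [|a k _ IH|k k0 _ IH].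
- by rewrite /wt big_seq1.
- by move: IH; rewrite hoffman_dual_inc_head !wt_cons /dep /=; lia.
- rewrite hoffman_dual_cons1 // wt_cons.
  move: IH (@hoffman_dual_neq0 k); rewrite /dep.
  by case: (hoffman_dual k) => //= b l; lia.
Qed.

End HoffmanDual.

(** * Multiple harmonic q-sums *)

Section NestedSums.
Variables (C : fieldType) (q : C).

Fixpoint nested_sum (k : seq nat) (n : nat) : C :=
  if k is a :: k' then \sum_(1 <= m < n) Fq q a m * nested_sum k' m else 1.

Lemma z_nested_sum n k : z n k q = nested_sum k n.
Proof.
pose f (m : seq nat) := \prod_(j < size k) Fq q (nth 0%N k j) (nth 0%N m j).
transitivity (\sum_(m <- decreasing_seqs (size k) n) f m).
  rewrite -(@sum_vals _ (size k) n _ (fun m => sorted gtn m && all (leq 1) m)).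
  - apply: eq_bigr => m _; apply: eq_bigr => j _; congr Fq.
    by rewrite /vals (nth_map (tnth m j)) ?size_tuple // -tnth_nth.
  - exact: decreasing_seqs_uniq.
  - by move=> e; rewrite mem_decreasing_seqs.
rewrite {}/f; elim: k n => [|a k IH] n /=.
  by rewrite big_seq1 big_ord0.
rewrite big_allpairs_dep; apply: eq_bigr => m _.
rewrite -IH big_distrr; apply: eq_bigr => s _ /=.
by rewrite big_ord_recl.
Qed.

(* The part of [nested_sum k n] in which the largest index is [m]. *)
Definition head_term (k : seq nat) (m : nat) : C :=
  if k is a :: k' then Fq q a m * nested_sum k' m else 0.

Lemma nested_sum_head k n : k <> [::] ->
  nested_sum k n = \sum_(1 <= m < n) head_term k m.
Proof. by case: k. Qed.

Lemma head_term_cons1 k m : k <> [::] ->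
  head_term (1%N :: k) m =
  (qint q m)^-1 * \sum_(1 <= m' < m) head_term k m'.
Proof.
by move=> k0; rewrite /= -nested_sum_head // /Fq subnn mul0n expr0 expr1 mul1r.
Qed.

(** F_(a+2)(m) is q^m / [m] times F_(a+1)(m), and the sum over the smaller indices does not involve
    the first entry. *)
Lemma head_term_inc a k m :
  head_term (a.+2 :: k) m = q ^+ m / qint q m * head_term (a.+1 :: k) m.
Proof.
rewrite /= mulrA; congr (_ * _); rewrite /Fq !subSS !subn0 mulSn exprD.
by rewrite (exprS (qint q m)) invfM mulrACA.
Qed.

End NestedSums.

(** * Recurrences for the sums over shifts, by largest index *)

Lemma addt_cons a k b e : addt (a :: k) (b :: e) = (a + b)%N :: addt k e.
Proof. by []. Qed.

Lemma addt_neq0 k e : k <> [::] -> size e = size k -> addt k e <> [::].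
Proof. by case: k e => [|? ?] [|? ?]. Qed.

Section ShiftSums.
Variables (C : fieldType) (q : C).

(* The coefficients of t^l in L_k(p) and R_k(m). *)
Definition dual_shift_sum (k : seq nat) (l p : nat) : C :=
  \sum_(e <- weak_compositions (size (hoffman_dual k)) l)
     head_term q (hoffman_dual (addt (hoffman_dual k) e)) p.

Definition shift_sum (k : seq nat) (l m : nat) : C :=
  \sum_(e <- weak_compositions (size k) l) head_term q (addt k e) m.

Lemma shift_sum1 l m :
  shift_sum [:: 1%N] l m =
  if l is l'.+1 then q ^+ m / qint q m * shift_sum [:: 1%N] l' m
  else (qint q m)^-1.
Proof.
rewrite /shift_sum; case: l => [|l].
  by rewrite big_seq1 /= /Fq subnn mul0n expr0 expr1 mul1r mulr1.
(* No composition of [l.+1] of length 1 starts with 0, so by computation only the second half of the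
   enumeration remains. *)
rewrite -[weak_compositions _ _]/(map inc_head (weak_compositions 1 l)) big_map.
rewrite big_distrr.
apply: eq_big_seq => e; rewrite mem_weak_compositions.
case: e => [|b e] //= _.
exact: (head_term_inc q b [seq p.1 + p.2 | p <- zip [::] e]%N).
Qed.

Lemma shift_sum_inc a k l m :
  shift_sum (a.+2 :: k) l m = q ^+ m / qint q m * shift_sum (a.+1 :: k) l m.
Proof.
rewrite /shift_sum big_distrr; apply: eq_big_seq => e.
by rewrite mem_weak_compositions; case: e => [|b e] //= _; apply: head_term_inc.
Qed.

(** A shift whose first entry is 0 leaves the prepended 1 intact, which gives the sum over m' < m; a
    positive first entry is lowered by 1 at the cost of a factor q^m / [m]. *)
Lemma shift_sum_cons1 k l m : k <> [::] ->
  shift_sum (1%N :: k) l m =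
    (if l is l'.+1 then q ^+ m / qint q m * shift_sum (1%N :: k) l' m else 0) +
    (qint q m)^-1 * \sum_(1 <= m' < m) shift_sum k l m'.
Proof.
move=> k0.
have first_part : \sum_(e <- map (cons 0%N) (weak_compositions (size k) l))
    head_term q (addt (1%N :: k) e) m =
    (qint q m)^-1 * \sum_(1 <= m' < m) shift_sum k l m'.
  rewrite big_map exchange_big big_distrr; apply: eq_big_seq => e.
  rewrite mem_weak_compositions => /andP[/eqP sz _].
  rewrite addt_cons addn0 head_term_cons1 //.
  by case: k e k0 sz => [|? ?] [|? ?].
case: l first_part => [|l] <-; first by rewrite add0r.
rewrite {1}/shift_sum [size _]/= weak_compositionsSS big_cat addrC.
congr (_ + _).
rewrite big_map big_distrr; apply: eq_big_seq => e.
rewrite mem_weak_compositions; case: e => [|b e] //= _.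
exact: (head_term_inc q b (addt k e)).
Qed.

Lemma dual_shift_sum1 l p :
  dual_shift_sum [:: 1%N] l p =
  if l is l'.+1
  then (qint q p)^-1 * \sum_(1 <= p' < p) dual_shift_sum [:: 1%N] l' p'
  else (qint q p)^-1.
Proof.
rewrite /dual_shift_sum; case: l => [|l].
  by rewrite big_seq1 /= /Fq subnn mul0n expr0 expr1 mul1r mulr1.
rewrite -[weak_compositions _ _]/(map inc_head (weak_compositions 1 l)) big_map.
rewrite exchange_big big_distrr.
apply: eq_big_seq => e; rewrite mem_weak_compositions.
case: e => [|b e] //= _.
rewrite -[hoffman_dual [:: 1]]/[:: 1] !addt_cons !add1n.
by rewrite hoffman_dual_inc_head head_term_cons1 //; apply: hoffman_dual_neq0.
Qed.

(** The dual starts with a new entry 1. If the shift leaves it at 1, dualizing back increases the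
    first entry; otherwise dualizing back prepends a 1, and the shift can be lowered by 1. *)
Lemma dual_shift_sum_inc a k l p :
  dual_shift_sum (a.+2 :: k) l p =
    q ^+ p / qint q p * dual_shift_sum (a.+1 :: k) l p +
    (if l is l'.+1 then
       (qint q p)^-1 * \sum_(1 <= p' < p) dual_shift_sum (a.+2 :: k) l' p'
     else 0).
Proof.
rewrite /dual_shift_sum hoffman_dual_inc_head [size (1%N :: _)]/=.
set d := hoffman_dual _.
have first_part l' : \sum_(e <- map (cons 0%N) (weak_compositions (size d) l'))
    head_term q (hoffman_dual (addt (1%N :: d) e)) p =
    q ^+ p / qint q p * \sum_(e <- weak_compositions (size d) l')
      head_term q (hoffman_dual (addt d e)) p.
  rewrite big_map big_distrr; apply: eq_big_seq => e.
  rewrite mem_weak_compositions => /andP[/eqP sz _].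
  rewrite addt_cons addn0 hoffman_dual_cons1; last first.
    by apply: addt_neq0 => //; apply: hoffman_dual_neq0.
  move: (@hoffman_dual_neq0 (addt d e)) (positive_hoffman_dual (addt d e)).
  by case: (hoffman_dual _) => [|[|b] d'] // _ _; apply: head_term_inc.
case: l => [|l]; rewrite ?weak_compositionsSS ?big_cat first_part ?addr0 //.
congr (_ + _); rewrite big_map exchange_big big_distrr; apply: eq_big_seq => e.
rewrite mem_weak_compositions; case: e => [|b e] //= _.
rewrite !addt_cons !add1n hoffman_dual_inc_head head_term_cons1 //.
exact: hoffman_dual_neq0.
Qed.

(** The dual now starts with an entry at least 2, so dualizing back prepends a 1 whatever the shift;
    no case on [l] arises. *)
Lemma dual_shift_sum_cons1 k l p : k <> [::] ->
  dual_shift_sum (1%N :: k) l p =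
  (qint q p)^-1 * \sum_(1 <= p' < p) dual_shift_sum k l p'.
Proof.
move=> k0; rewrite /dual_shift_sum hoffman_dual_cons1 //.
move: (@hoffman_dual_neq0 k) (positive_hoffman_dual k).
case: (hoffman_dual k) => [|[|b] d] // _ _.
rewrite exchange_big big_distrr; apply: eq_big_seq => e.
rewrite mem_weak_compositions; case: e => [|c e] //= _.
rewrite !addt_cons !addSn hoffman_dual_inc_head head_term_cons1 //.
exact: hoffman_dual_neq0.
Qed.

End ShiftSums.

(** * The triangular kernel *)

Section EqUpto.
Variables (C : fieldType) (N : nat).

(** Congruence modulo ['X^N], that is, equality of truncated power series in t. *)
Definition eq_upto (f g : {poly C}) := forall a, (a < N)%N -> f`_a = g`_a.

Lemma eq_upto_refl f : eq_upto f f.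
Proof. by []. Qed.

Lemma eq_upto_sym f g : eq_upto f g -> eq_upto g f.
Proof. by move=> fg a aN; rewrite fg. Qed.

Lemma eq_upto_trans g f h : eq_upto f g -> eq_upto g h -> eq_upto f h.
Proof. by move=> fg gh a aN; rewrite fg // gh. Qed.

Lemma eq_uptoD f g f' g' :
  eq_upto f g -> eq_upto f' g' -> eq_upto (f + f') (g + g').
Proof. by move=> fg fg' a aN; rewrite !coefD fg // fg'. Qed.

Lemma eq_uptoMl h f g : eq_upto f g -> eq_upto (h * f) (h * g).
Proof.
move=> fg a aN; rewrite !coefM; apply: eq_bigr => i _.
by rewrite fg // (leq_ltn_trans (leq_subr _ _)).
Qed.

Lemma eq_upto_sum_nat i j (f g : nat -> {poly C}) :
  (forall m, (i <= m < j)%N -> eq_upto (f m) (g m)) ->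
  eq_upto (\sum_(i <= m < j) f m) (\sum_(i <= m < j) g m).
Proof.
move=> fg a aN; rewrite !coef_sum; apply: eq_big_nat => m m_ij.
exact: fg.
Qed.

End EqUpto.

Lemma exchange_triangular_sum (A : comNzRingType) (w f : nat -> A) N :
  \sum_(1 <= m < N) w m * \sum_(1 <= m' < m) f m' =
  \sum_(1 <= m' < N) f m' * \sum_(m'.+1 <= m < N) w m.
Proof.
elim: N => [|[|N] IH]; [by rewrite !big_geq | by rewrite !big_geq |].
rewrite big_nat_recr // IH [RHS]big_nat_recr //= [X in f _ * X]big_geq //.
rewrite mulr0 addr0 [w _ * _]mulrC big_distrl -big_split.
apply: eq_big_nat => m /andP[_ mN] /=.
by rewrite [in RHS]big_nat_recr //= mulrDr.
Qed.

Section Kernel.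
Variables (C : fieldType) (q : C) (n : nat).
Hypothesis q_neq1 : forall i, (0 < i < n)%N -> 1 - q ^+ i != 0.

Let Q : {poly C} := q%:P.
Let u : {poly C} := 1 + (1 - q)%:P * 'X.
Let d i : {poly C} := 1 - Q ^+ i.
Let c i : {poly C} := ((1 - q ^+ i)^-1)%:P.
Let e : {poly C} := (1 - q)%:P.

Let dc i : (0 < i < n)%N -> d i * c i = 1.
Proof.
move=> i_n; rewrite /d /Q -polyC_exp -polyC1 -polyCB -polyCM divff //.
exact: q_neq1.
Qed.

(** The quotient (uq; q)_m / (q; q)_m of q-shifted factorials. *)
Fixpoint kerA (m : nat) : {poly C} :=
  if m is m'.+1 then c m * (1 - u * Q ^+ m) * kerA m' else 1.

(** Formally u^j (1/u; q)_j / (q; q)_j, a coefficient of the q-binomial series. *)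
Fixpoint kerB (j : nat) : {poly C} :=
  if j is j'.+1 then c j * (u - Q ^+ j') * kerB j' else 1.

Definition sumB (j : nat) : {poly C} := \sum_(0 <= i < j) kerB i.

Lemma sumB0 : sumB 0 = 0.
Proof. by rewrite /sumB big_geq. Qed.

Lemma sumBS j : sumB j.+1 = sumB j + kerB j.
Proof. by rewrite /sumB big_nat_recr. Qed.

(** In the induction (u - q^j) B_j equals (1 - q^(j+1)) B_(j+1), and adding (u - 1) B_(j+1) turns
    the factor into u - q^(j+1). *)
Lemma mul_sumBS j : (j < n)%N ->
  (u - 1) * sumB j.+1 = (u - Q ^+ j) * kerB j.
Proof.
elim: j => [|j IH] jn; first by rewrite sumBS sumB0 add0r expr0.
rewrite sumBS mulrDr IH 1?ltnW //.
have dcj : d j.+1 * c j.+1 = 1 by apply: dc.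
rewrite -[X in X + _]mul1r -{1}dcj /= /d; ring.
Qed.

Lemma mul_kerB j : (j < n)%N -> d j * kerB j = (u - 1) * sumB j.
Proof.
move=> jn; apply: (addIr ((u - 1) * kerB j)).
by rewrite -mulrDr -sumBS mul_sumBS // /d; ring.
Qed.

(** Moving one step from S to A costs a term with factor 1 - q^(a+1+j), which depends only on the
    sum of the two indices: iterating telescopes, and the term vanishes when that sum is n. *)
Lemma kerA_sumB a j : (a.+1 < n)%N -> (j < n)%N ->
  kerA a * sumB j.+1 =
  d (a.+1 + j) * (c a.+1 * kerA a * kerB j) + kerA a.+1 * sumB j.
Proof.
move=> an jn; have dca : d a.+1 * c a.+1 = 1 by apply: dc.
rewrite sumBS -[LHS]mul1r -{1}dca /=.
move: (mul_kerB jn); rewrite /d exprD.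
move: (kerA a) (sumB j) (kerB j) (c a.+1) (Q ^+ a.+1) (Q ^+ j) => x s b y v w E.
have {}E : (u - 1) * s - (1 - w) * b = 0 by rewrite E subrr.
apply/eqP; rewrite -subr_eq0; apply/eqP.
(* The difference of the two sides is this multiple of the relation [mul_kerB]. *)
transitivity (y * x * v * ((u - 1) * s - (1 - w) * b)); first by ring.
by rewrite E mulr0.
Qed.

Definition transform (f : nat -> {poly C}) (p : nat) : {poly C} :=
  \sum_(1 <= m < p.+1) kerA m * kerB (p - m) * f m.

(** For fixed m the difference p - m runs from 0 to N - m - 1, so the B factors add up to
    S_(N-m). *)
Lemma sum_transform f N :
  \sum_(1 <= p < N) transform f p =
  \sum_(1 <= m < N) kerA m * sumB (N - m) * f m.
Proof.
elim: N => [|[|N] IH]; [by rewrite !big_geq | by rewrite !big_geq |].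
rewrite big_nat_recr // IH [RHS]big_nat_recr //= /transform.
rewrite [X in _ + X = _]big_nat_recr //= addrA -big_split subnn subSnn.
rewrite sumBS sumB0 add0r; congr (_ + _); apply: eq_big_nat => m /andP[_ mN] /=.
have -> : (N.+2 - m = (N.+1 - m).+1)%N by lia.
by rewrite sumBS; ring.
Qed.

(** Iterating [kerA_sumB] along a + j = p keeps the factor [d p] and ends at S_0 = 0. *)
Lemma sum_kerA_kerB a p : (a <= p < n)%N ->
  d p * \sum_(a.+1 <= m < p.+1) c m * kerA m.-1 * kerB (p - m) =
  kerA a * sumB (p - a).
Proof.
case/andP=> ap; rewrite -(subnKC ap); move: (p - a)%N => j {p ap}.
elim: j a => [|j IH] a an; first by rewrite addn0 subnn big_geq // sumB0 !mulr0.
have -> : (a + j.+1 - a = j.+1)%N by lia.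
rewrite big_ltn; last by lia.
rewrite mulrDr addnS -addSn IH; last by lia.
rewrite [X in kerA a.+1 * sumB X](_ : _ = j); last by lia.
rewrite [X in kerB X](_ : _ = j); last by lia.
by rewrite kerA_sumB //; lia.
Qed.

Lemma kerA_pred m : (0 < m < n)%N ->
  kerA m = c m * kerA m.-1 * (1 - u * Q ^+ m).
Proof. by case: m => // m _ /=; rewrite mulrAC. Qed.

Lemma transform_inc f f' p :
  (forall m, (0 < m < n)%N -> d m * f' m = e * Q ^+ m * f m) ->
  (0 < p < n)%N ->
  d p * transform f' p =
  e * Q ^+ p * transform f p + (u - 1) * \sum_(1 <= p' < p) transform f' p'.
Proof.
case: p => // p ff' pn; rewrite sum_transform /transform.
(* The added term m = p + 1 is zero because S_0 = 0. *)
have -> : \sum_(1 <= m < p.+1) kerA m * sumB (p.+1 - m) * f' m =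
          \sum_(1 <= m < p.+2) kerA m * sumB (p.+1 - m) * f' m.
  by rewrite [RHS]big_nat_recr //= subnn sumB0 mulr0 mul0r addr0.
rewrite !big_distrr -big_split; apply: eq_big_nat => m mp /=.
have mB := @mul_kerB (p.+1 - m) ltac:(lia).
have fm := ff' m ltac:(lia).
have QE : Q ^+ p.+1 = Q ^+ (p.+1 - m) * Q ^+ m by rewrite -exprD subnK //; lia.
(* With p + 1 for p, this splits 1 - q^p as (1 - q^(p-m)) + q^(p-m) (1 - q^m): [mul_kerB] handles
   the first part and the hypothesis on [f'] the second. *)
transitivity (kerA m * (d (p.+1 - m) * kerB (p.+1 - m) * f' m +
    Q ^+ (p.+1 - m) * (d m * f' m) * kerB (p.+1 - m))).
  by rewrite /d QE; ring.
by rewrite mB fm QE; ring.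
Qed.

(** Isolates the factor 1 - u q^m, on which the hypotheses of [transform_1] and [transform_cons1]
    bear. *)
Lemma transform_factor f p : (0 < p < n)%N ->
  transform f p = \sum_(1 <= m < p.+1) c m * kerA m.-1 * kerB (p - m) *
                                       ((1 - u * Q ^+ m) * f m).
Proof.
move=> pn; apply: eq_big_nat => m mp.
by rewrite kerA_pred; [ring | lia].
Qed.

Lemma kerA_sumB_const m : q ^+ n = 1 -> (m < n)%N ->
  kerA m * sumB (n - m) = sumB n.
Proof.
move=> qn1; elim: m => [|m IH] mn; first by rewrite subn0 mul1r.
rewrite -IH ?(ltnW mn) //.
have -> : (n - m = (n - m.+1).+1)%N by lia.
rewrite kerA_sumB //; last by lia.
by rewrite subnKC ?(ltnW mn) // /d /Q -polyC_exp qn1 subrr mul0r add0r.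
Qed.

Lemma prod_kerB j : (j < n)%N ->
  kerB j * \prod_(1 <= i < j.+1) d i = \prod_(0 <= i < j) (u - Q ^+ i).
Proof.
elim: j => [|j IH] jn; first by rewrite !big_geq // mulr1.
rewrite big_nat_recr // [RHS]big_nat_recr //= -IH ?(ltnW jn) //.
have dcj : d j.+1 * c j.+1 = 1 by apply: dc.
transitivity (d j.+1 * c j.+1 *
    (kerB j * \prod_(1 <= i < j.+1) d i * (u - Q ^+ j))); first by ring.
by rewrite dcj mul1r.
Qed.

Lemma prod_primitive_root : n.-primitive_root q ->
  \prod_(1 <= i < n) (1 - q ^+ i) = n%:R.
Proof.
move=> q_prim; have n_gt0 := prim_order_gt0 q_prim.
(* The factorization of X^n - 1 divided by its factor X - 1 for i = 0, to be evaluated at 1. *)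
have : \prod_(1 <= i < n) ('X - (q ^+ i)%:P) = \sum_(i < n) 'X^i :> {poly C}.
  apply: (mulfI (monic_neq0 (monicXsubC 1))).
  rewrite polyC1 -subrX1 -(factor_Xn_sub_1 q_prim) [RHS]big_ltn //.
move/(congr1 (horner^~ 1)); rewrite horner_prod horner_sum.
under eq_bigr do rewrite hornerXsubC.
move=> ->; under eq_bigr do rewrite hornerXn expr1n.
by rewrite sumr_const card_ord.
Qed.

Lemma mul_sumB_order : n.-primitive_root q ->
  n%:R * (u - 1) * sumB n = u ^+ n - 1.
Proof.
move=> q_prim; have n_gt0 := prim_order_gt0 q_prim.
have -> : u ^+ n - 1 = \prod_(0 <= i < n) (u - Q ^+ i).
  have := congr1 (comp_poly u) (factor_Xn_sub_1 q_prim).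
  rewrite rmorph_prod rmorphB rmorphXn rmorph1 /= comp_polyX => <-.
  apply: eq_bigr => i _.
  by rewrite comp_polyB comp_polyX comp_polyC /Q polyC_exp.
have dE : \prod_(1 <= i < n) d i = n%:R.
  rewrite -polyC_natr -(prod_primitive_root q_prim) rmorph_prod.
  by apply: eq_bigr => i _; rewrite /= polyCB polyC_exp.
(* S_n is reached from [mul_sumBS] at the last admissible index n - 1. *)
case: n n_gt0 dE mul_sumBS prod_kerB => // n' _ dE sE pE.
rewrite big_nat_recr // -pE //= dE -mulrA sE //.
by ring.
Qed.

Lemma coef_sumB j : n.-primitive_root q -> (1 < n)%N ->
  (sumB n)`_j = n%:R^-1 * 'C(n, j + 1)%:R * (1 - q) ^+ j.
Proof.
move=> q_prim n_gt1.
have q1 : 1 - q != 0 by have := @q_neq1 1 n_gt1; rewrite expr1.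
have n0 := prim_root_natf_neq0 q_prim.
have uE : u ^+ n = \poly_(i < n.+1) ((1 - q) ^+ i *+ 'C(n, i)).
  rewrite poly_def exprDn; apply: eq_bigr => i _.
  by rewrite expr1n mul1r exprMn -polyC_exp mul_polyC scalerMnl.
(* Since u - 1 = (1 - q) t, the coefficient of t^j in S_n appears at t^(j+1). *)
have := congr1 (fun f : {poly C} => f`_j.+1) (mul_sumB_order q_prim).
have -> : n%:R * (u - 1) * sumB n = (n%:R * (1 - q))%:P * (sumB n * 'X).
  by rewrite polyCM polyC_natr /u; ring.
rewrite coefCM coefMX /= coefB coef1 subr0 uE coef_poly addn1 => sE.
apply: (mulfI (mulf_neq0 n0 q1)); rewrite {}sE.
case: ltnP => [_|nj]; last by rewrite bin_small // !mulr0 mul0r mulr0.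
by rewrite exprS -mulr_natl; field.
Qed.

(** * Recurrences modulo a power of t, and the generating series *)

Variable N : nat.
Notation "f =t g" := (eq_upto N f g) (at level 70).

Lemma eq_upto_cancel p f g : (0 < p < n)%N -> d p * f =t d p * g -> f =t g.
Proof.
move=> pn /(@eq_uptoMl _ _ (c p) _ _).
by rewrite !mulrA [c p * _]mulrC dc // !mul1r.
Qed.

(** After the two summations are exchanged, [sum_kerA_kerB] evaluates the inner sum to A_m S_(p-m),
    which [sum_transform] recognizes as a sum of transforms. *)
Lemma transform_cons1 f f' p :
  (forall m, (0 < m < n)%N ->
     (1 - u * Q ^+ m) * f' m =t e * \sum_(1 <= m' < m) f m') ->
  (0 < p < n)%N ->
  d p * transform f' p =t e * \sum_(1 <= p' < p) transform f p'.
Proof.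
move=> ff' pn; rewrite transform_factor //.
pose w m := c m * kerA m.-1 * kerB (p - m).
apply: (@eq_upto_trans _ _
    (d p * \sum_(1 <= m < p.+1) w m * (e * \sum_(1 <= m' < m) f m'))).
  apply: eq_uptoMl; apply: eq_upto_sum_nat => m mp; apply: eq_uptoMl.
  by apply: ff'; lia.
under eq_bigr do rewrite mulrCA.
rewrite -big_distrr /= exchange_triangular_sum mulrCA sum_transform.
apply: eq_uptoMl; rewrite big_nat_recr /=; last by lia.
rewrite [X in f p * X]big_geq // mulr0 addr0 big_distrr /=.
apply: eq_upto_sum_nat => m mp; rewrite mulrCA sum_kerA_kerB; last by lia.
by rewrite mulrC.
Qed.

Lemma transform_1 f p :
  (forall m, (0 < m < n)%N -> (1 - u * Q ^+ m) * f m =t e) ->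
  (0 < p < n)%N ->
  d p * transform f p =t e + (u - 1) * \sum_(1 <= p' < p) transform f p'.
Proof.
move=> fe.
have trf p' : (0 < p' < n)%N -> d p' * transform f p' =t e * sumB p'.
  move=> pn; rewrite transform_factor //.
  have := @sum_kerA_kerB 0 p' ltac:(lia).
  rewrite subn0 [kerA 0](_ : _ = 1) // mul1r => <-.
  rewrite mulrCA; apply: eq_uptoMl; rewrite big_distrr.
  apply: eq_upto_sum_nat => m mp /=.
  by rewrite [e * _]mulrC; apply: eq_uptoMl; apply: fe; lia.
move=> pn; apply: eq_upto_trans (trf p pn) _.
(* The term B_0 = 1 gives [e]. For i > 0, e B_i is u - 1 times the transform at i, by [mul_kerB] and
   [trf]. *)
rewrite /sumB big_ltn; last by lia.
rewrite mulrDr mulr1; apply: eq_uptoD; first exact: eq_upto_refl.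
rewrite !big_distrr; apply: eq_upto_sum_nat => p' p'p /=.
have p'n : (0 < p' < n)%N by lia.
apply: (@eq_upto_cancel p') => //.
rewrite mulrCA mul_kerB; last by lia.
rewrite mulrCA [d p' * _]mulrCA.
by apply: eq_uptoMl; apply: eq_upto_sym; apply: trf.
Qed.

(** The recurrence determines its solution, because [d p] is invertible and the right-hand side
    involves only smaller indices. *)
Lemma eq_upto_recurrence (g f f' : nat -> {poly C}) :
  (forall p, (0 < p < n)%N ->
     d p * f p =t g p + (u - 1) * \sum_(1 <= p' < p) f p') ->
  (forall p, (0 < p < n)%N ->
     d p * f' p =t g p + (u - 1) * \sum_(1 <= p' < p) f' p') ->
  forall p, (0 < p < n)%N -> f p =t f' p.
Proof.
move=> fE f'E p; have [k] := ubnP p; elim: k p => // k IH p pk pn.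
apply: (@eq_upto_cancel p) => //.
apply: eq_upto_trans (fE p pn) _; apply: eq_upto_sym.
apply: eq_upto_trans (f'E p pn) _; apply: eq_uptoD; first exact: eq_upto_refl.
apply: eq_uptoMl; apply: eq_upto_sum_nat => p' p'p.
by apply: eq_upto_sym; apply: IH; lia.
Qed.

(* L_k(p) and R_k(m) are power series in t, truncated here; all relations between
   them are taken modulo 'X^N. *)
Definition dual_series (k : seq nat) (p : nat) : {poly C} :=
  \poly_(l < N) dual_shift_sum q k l p.

Definition series (k : seq nat) (m : nat) : {poly C} :=
  \poly_(l < N) shift_sum q k l m.

Let coef_dM p f l : (d p * f)`_l = (1 - q ^+ p) * f`_l.
Proof. by rewrite /d /Q -polyC_exp -polyC1 -polyCB coefCM. Qed.

Let coef_uM f l :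
  ((u - 1) * f)`_l = (1 - q) * (if l is l'.+1 then f`_l' else 0).
Proof. by rewrite /u addrC addKr -mulrA coefCM coefXM; case: l. Qed.

Let coef_factorM m f l : ((1 - u * Q ^+ m) * f)`_l =
  (1 - q ^+ m) * f`_l - (1 - q) * q ^+ m * (if l is l'.+1 then f`_l' else 0).
Proof.
have -> : (1 - u * Q ^+ m) * f = d m * f - (u - 1) * ((q ^+ m)%:P * f).
  by rewrite polyC_exp -/Q /d; ring.
rewrite coefB coef_dM coef_uM.
by case: l => [|l]; rewrite ?coefCM ?mulr0 ?mulrA.
Qed.

Let qint_inv p : (0 < p < n)%N -> (1 - q ^+ p) * (qint q p)^-1 = 1 - q.
Proof. by move=> /q_neq1 qp; rewrite /qint invf_div mulrC divfK. Qed.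

Let coef_dual_series k p l : (l < N)%N ->
  (dual_series k p)`_l = dual_shift_sum q k l p.
Proof. by move=> lN; rewrite coef_poly lN. Qed.

Let coef_series k p l : (l < N)%N -> (series k p)`_l = shift_sum q k l p.
Proof. by move=> lN; rewrite coef_poly lN. Qed.

(** Multiplying the coefficient recurrence by 1 - q^p turns 1/[p] into 1 - q, and passing from [l']
    to [l'.+1] is multiplication by t; together they give u - 1. *)
Lemma dual_series1 p : (0 < p < n)%N ->
  d p * dual_series [:: 1%N] p =t
  e + (u - 1) * \sum_(1 <= p' < p) dual_series [:: 1%N] p'.
Proof.
move=> pn l lN; rewrite coefD coef_dM coef_uM coefC coef_dual_series //.
rewrite dual_shift_sum1; case: l lN => [|l] lN.
  by rewrite qint_inv // mulr0 addr0.
rewrite mulrA qint_inv // add0r coef_sum; congr (_ * _).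
by apply: eq_bigr => p' _; rewrite coef_dual_series // ltnW.
Qed.

Lemma dual_series_inc a k p : (0 < p < n)%N ->
  d p * dual_series (a.+2 :: k) p =t
  e * Q ^+ p * dual_series (a.+1 :: k) p +
    (u - 1) * \sum_(1 <= p' < p) dual_series (a.+2 :: k) p'.
Proof.
move=> pn l lN; rewrite coefD coef_dM coef_uM coef_dual_series //.
rewrite dual_shift_sum_inc mulrDr; congr (_ + _).
  rewrite mulrA mulrCA qint_inv // /e /Q -polyC_exp -polyCM coefCM.
  by rewrite coef_dual_series // [_ * (1 - q)]mulrC.
case: l lN => [|l] lN; first by rewrite !mulr0.
rewrite mulrA qint_inv // coef_sum; congr (_ * _).
by apply: eq_bigr => p' _; rewrite coef_dual_series // ltnW.
Qed.

Lemma dual_series_cons1 k p : k <> [::] -> (0 < p < n)%N ->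
  d p * dual_series (1%N :: k) p =t e * \sum_(1 <= p' < p) dual_series k p'.
Proof.
move=> k0 pn l lN; rewrite coef_dM coefCM coef_dual_series //.
rewrite dual_shift_sum_cons1 // mulrA qint_inv // coef_sum; congr (_ * _).
by apply: eq_bigr => p' _; rewrite coef_dual_series.
Qed.

(** A geometric series in t: 1 - u q^m is (1 - q^m) (1 - t q^m / [m]). *)
Lemma series1 m : (0 < m < n)%N ->
  (1 - u * Q ^+ m) * series [:: 1%N] m =t e.
Proof.
move=> mn l lN; rewrite coef_factorM coefC coef_series // shift_sum1.
case: l lN => [|l] lN; first by rewrite qint_inv // mulr0 subr0.
rewrite coef_series ?(ltnW lN) // mulrA mulrCA qint_inv //.
by rewrite [_ * (1 - q)]mulrC subrr.
Qed.

(** The degree in t does not shift, so the truncations agree exactly, as [transform_inc]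
    requires. *)
Lemma series_inc a k m : (0 < m < n)%N ->
  d m * series (a.+2 :: k) m = e * Q ^+ m * series (a.+1 :: k) m.
Proof.
move=> mn; apply/polyP => l; rewrite coef_dM /e /Q -polyC_exp -polyCM coefCM.
rewrite !coef_poly; case: ltnP => _; last by rewrite !mulr0.
by rewrite shift_sum_inc mulrA mulrCA qint_inv // [_ * (1 - q)]mulrC.
Qed.

Lemma series_cons1 k m : k <> [::] -> (0 < m < n)%N ->
  (1 - u * Q ^+ m) * series (1%N :: k) m =t
  e * \sum_(1 <= m' < m) series k m'.
Proof.
move=> k0 mn l lN; rewrite coef_factorM coefCM coef_series //.
rewrite shift_sum_cons1 //.
have -> : (\sum_(1 <= m' < m) series k m')`_l =
    \sum_(1 <= m' < m) shift_sum q k l m'.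
  by rewrite coef_sum; apply: eq_bigr => m' _; rewrite coef_series.
rewrite mulrDr addrAC [X in _ + X]mulrA qint_inv //.
case: l lN => [|l] lN; first by rewrite !mulr0 subr0 add0r.
rewrite coef_series ?(ltnW lN) // mulrA mulrCA qint_inv //.
by rewrite [_ * (1 - q)]mulrC subrr add0r.
Qed.

(** For (1) and for an increased first entry, both sides solve the same recurrence in p; for a
    prepended 1, both are given directly by the series of [k]. *)
Lemma dual_series_transform k : k <> [::] -> positive k ->
  forall p, (0 < p < n)%N -> dual_series k p =t transform (series k) p.
Proof.
move: k; apply: positive_tuple_ind => [|a k _ IH|k k0 _ IH].
- apply: (@eq_upto_recurrence (fun _ => e)); first exact: dual_series1.
  by move=> p; apply: transform_1; apply: series1.
- apply: (@eq_upto_recurrence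
    (fun p => e * Q ^+ p * dual_series (a.+1 :: k) p)).
    exact: dual_series_inc.
  move=> p pn; rewrite (@transform_inc (series (a.+1 :: k))) //.
    apply: eq_uptoD => //; apply: eq_uptoMl; apply: eq_upto_sym; exact: IH.
  exact: series_inc.
- move=> p pn; apply: (@eq_upto_cancel p) => //.
  apply: eq_upto_trans (dual_series_cons1 k0 pn) _; apply: eq_upto_sym.
  apply: eq_upto_trans (@transform_cons1 (series k) _ p _ pn) _.
    by move=> m; apply: series_cons1.
  apply: eq_uptoMl; apply: eq_upto_sum_nat => p' p'p.
  by apply: eq_upto_sym; apply: IH; lia.
Qed.

Lemma sum_dual_series k : k <> [::] -> positive k -> q ^+ n = 1 ->
  \sum_(1 <= p < n) dual_series k p =t
  sumB n * \sum_(1 <= m < n) series k m.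
Proof.
move=> k0 k_pos qn1.
apply: (@eq_upto_trans _ _ (\sum_(1 <= p < n) transform (series k) p)).
  by apply: eq_upto_sum_nat => p pn; apply: dual_series_transform.
rewrite sum_transform big_distrr; apply: eq_upto_sum_nat => m /andP[_ mn].
by rewrite kerA_sumB_const.
Qed.

End Kernel.

(** * Comparison of the coefficients of t^m *)

Unset Implicit Arguments.

Theorem theorem4p3 (C : numClosedFieldType) (k : seq nat)
    (k_neq0 : k <> [::]) (k_pos : positive k)
    (r s : nat) (def_r : r = dep k) (def_s : s = dep (hoffman_dual k))
    (n : nat) (n_ge2 : (2 <= n)%N)
    (zeta : C) (zeta_prim : n.-primitive_root zeta) :
  s = (wt k - r + 1)%N /\
  forall m : nat, (r + m + 1 <= n)%N ->
  \sum_(e : s.-tuple 'I_m.+1 | wt (vals e) == m)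
     z n (hoffman_dual (addt (hoffman_dual k) (vals e))) zeta
  = \sum_(l < m.+1)
      n%:R^-1 * 'C(n, m - l + 1)%:R * (1 - zeta) ^+ (m - l) *
      \sum_(e' : r.-tuple 'I_l.+1 | wt (vals e') == l)
         z n (addt k (vals e')) zeta.
Proof.
split.
  have := size_hoffman_dual k_neq0 k_pos; rewrite -def_s -def_r.
  have : (0 < s)%N.
    by rewrite def_s; move: (@hoffman_dual_neq0 k); case: (hoffman_dual k).
  lia.
move=> m _; rewrite {}def_s {}def_r.
have q_neq1 i : (0 < i < n)%N -> 1 - zeta ^+ i != 0.
  move=> i_n; rewrite subr_eq0 eq_sym -(prim_order_dvd zeta_prim).
  by rewrite gtnNdvd //; lia.
rewrite (sum_weak_compositions _ _
  (fun e => z n (hoffman_dual (addt (hoffman_dual k) e)) zeta)).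
(* Truncation at order [m.+1] just keeps the coefficient of t^m. *)
have -> : \sum_(e <- weak_compositions (dep (hoffman_dual k)) m)
    z n (hoffman_dual (addt (hoffman_dual k) e)) zeta =
    (\sum_(1 <= p < n) dual_series zeta m.+1 k p)`_m.
  rewrite coef_sum; under [RHS]eq_bigr do rewrite coef_poly ltnSn.
  rewrite exchange_big; apply: eq_bigr => e _.
  by rewrite z_nested_sum nested_sum_head //; apply: hoffman_dual_neq0.
rewrite (sum_dual_series q_neq1 k_neq0 k_pos (prim_expr_order zeta_prim)) //.
(* In this form of the Cauchy product [l] indexes the series of [k], and [m - l] the coefficients of
   S_n. *)
rewrite coefMr; apply: eq_bigr => l _; rewrite coef_sumB //; congr (_ * _).
rewrite (sum_weak_compositions _ _ (fun e => z n (addt k e) zeta)) coef_sum.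
under eq_bigr do rewrite coef_poly ltn_ord.
rewrite exchange_big; apply: eq_big_seq => e.
rewrite mem_weak_compositions => /andP[/eqP sz _].
by rewrite z_nested_sum nested_sum_head //; apply: addt_neq0.
Qed.
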